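(* Let $n\ge 2$ and $1\le r\le n-1$. Then the $(r+1)$-component connectivity of the $n$-dimensional dual cube is $$c\kappa_{r+1}(D_n)=rn-\frac{r(r+1)}{2}+1.$$
   Context: The $n$-dimensional dual cube $D_n$ has vertex set all $(2n-1)$-bit binary strings $u_1u_2\cdots u_{2n-1}$. Two vertices $u,v$ are adjacent iff they differ in exactly one bit position $i$, and moreover: if $1\le i\le n-1$ then $u_{2n-1}=v_{2n-1}=0$; if $n\le i\le 2n-2$ then $u_{2n-1}=v_{2n-1}=1$; (if $i=2n-1$ there is no further condition). For a non-complete graph $G$ and integer $r\ge 2$, an $r$-component cut is a set $F\subseteq V(G)$ such that $G-F$ has at least $r$ connected components, and the $r$-component connectivity $c\kappa_r(G)$ is the minimum size of an $r$-component cut of $G$. *)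

(* Defs.v *)
From mathcomp Require Import all_boot.
Set Implicit Arguments. Unset Strict Implicit. Unset Printing Implicit Defensive.

(* Vertices of D_n: binary strings u_1 ... u_{2n-1}, encoded as functions
   from 'I_(2n-1) to bool; bit u_{i} is stored at index i-1. *)
Definition dcvert (n : nat) := {ffun 'I_(2 * n - 1) -> bool}.

(* Adjacency in the dual cube D_n (1-based position i corresponds to
   0-based index i-1; the last bit u_{2n-1} is at index 2n-2). *)
Definition dc_adj n : rel (dcvert n) := fun u v =>
  [exists i : 'I_(2 * n - 1),
     [&& u i != v i,
         [forall j, (j != i) ==> (u j == v j)] &
         if i < n - 1 then
           [forall j : 'I_(2 * n - 1), (j == 2 * n - 2 :> nat) ==> ~~ u j && ~~ v j]
         else if i < 2 * n - 2 then
           [forall j : 'I_(2 * n - 1), (j == 2 * n - 2 :> nat) ==> u j && v j]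
         else true]].

Section Graphs.
Variable T : finType.
Variable e : rel T.

Definition del_rel (F : {set T}) : rel T :=
  fun x y => [&& x \notin F, y \notin F & e x y].

Definition ncomp_del (F : {set T}) : nat :=
  n_comp (del_rel F) (~: F).

Definition is_rcut (r : nat) (F : {set T}) : bool := r <= ncomp_del F.

Definition complete_graph : bool := [forall x, forall y, (x != y) ==> e x y].

End Graphs.

Definition is_ckappa (T : finType) (e : rel T) (r k : nat) : Prop :=
  (exists F : {set T}, is_rcut e r F /\ #|F| = k) /\
  (forall F : {set T}, is_rcut e r F -> k <= #|F|).

(* Main.v *)
Require Import Defs.
From mathcomp Require Import all_boot.
From mathcomp Require Import zify.

Set Implicit Arguments.
Unset Strict Implicit.
Unset Printing Implicit Defensive.

(* Write m = n - 1. Every vertex of D_n lies in one of 2 * 2^m clusters, each an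
   m-cube; the clusters form two classes according to the last bit, and any two
   clusters of opposite classes are joined by exactly one edge.

   Lower bound. A cut F that is too small has fewer than 2^m elements, so each
   class contains a cluster avoiding F, and all such clean clusters lie in one
   component of the rest. The vertices S outside F and this component number at
   least r and avoid clean clusters. A set of a > 0 vertices of the m-cube has a
   closed neighborhood of size at least 1 + a (m + 1) - C(a + 1, 2). If some
   cluster contains at least r vertices of S, then F also meets the clusters of
   the opposite class containing their cross neighbors, so |F| is at least the
   size of the closed neighborhood of r vertices. Otherwise every cluster with
   x > 0 vertices of S contains at least 1 + x m - C(x + 1, 2) elements of F,
   and adding these bounds over at least two clusters suffices.

   Upper bound. The neighborhood of the r neighbors e_0, ..., e_{r-1} of the
   origin of one cluster isolates these r vertices. *)

(** * Triangular numbers and disjoint unions *)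

Lemma tri_add a b : 'C((a + b).+1, 2) = 'C(a.+1, 2) + 'C(b.+1, 2) + a * b.
Proof.
elim: b => [|b IHb]; first by rewrite muln0 !addn0.
by rewrite addnS binS IHb bin1 (binS b.+1) bin1; lia.
Qed.

Lemma tri_lt_exp2 m : 'C(m.+1, 2) < 2 ^ m.
Proof.
elim: m => // m IHm; rewrite binS bin1 expnS.
by have := ltn_expl m (isT : 1 < 2); lia.
Qed.

Lemma tri_half r : (r * (r + 1)) %/ 2 = 'C(r.+1, 2).
Proof. by rewrite bin2 divn2 addn1 mulnC. Qed.

Lemma card_disjoint_sub (T : finType) (A B C : {set T}) :
  A \subset C -> B \subset C -> [disjoint A & B] -> #|A| + #|B| <= #|C|.
Proof.
move=> AC BC dAB.
have -> : #|A| + #|B| = #|A :|: B|.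
  by apply/esym/eqP; rewrite (leq_card_setU A B).2.
by apply: subset_leq_card; rewrite subUset AC.
Qed.

(** * Closed neighborhoods and connectivity in the cube of subsets of [I] *)

Section Cube.
Variable I : finType.
Implicit Types x y : {set I}.

Definition flip (i : I) x : {set I} := [set j | (j \in x) (+) (j == i)].

Lemma flipK i : involutive (flip i).
Proof. by move=> x; apply/setP=> j; rewrite !inE -addbA addbb addbF. Qed.

Lemma flip_at i x : (i \in flip i x) = (i \notin x).
Proof. by rewrite !inE eqxx addbT. Qed.

Lemma flip_other i j x : j != i -> (j \in flip i x) = (j \in x).
Proof. by move=> /negbTE ji; rewrite !inE ji addbF. Qed.

(** Limiting the directions to [J] allows induction on subcubes without changing the type [I]. *)
Definition cnbhd (J : {set I}) (S : {set {set I}}) : {set {set I}} :=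
  [set y | (y \in S) || [exists i in J, flip i y \in S]].

Lemma cnbhdS (J J' : {set I}) (S S' : {set {set I}}) :
  J \subset J' -> S \subset S' -> cnbhd J S \subset cnbhd J' S'.
Proof.
move=> JJ SS; apply/subsetP=> y; rewrite !inE => /orP[/(subsetP SS)-> //|].
case/exists_inP=> i iJ yS; apply/orP; right; apply/exists_inP; exists i.
  exact: (subsetP JJ).
exact: (subsetP SS).
Qed.

Lemma cnbhd_fix (J : {set I}) (S : {set {set I}}) i b :
  i \notin J -> {in S, forall x, (i \in x) = b} ->
  {in cnbhd J S, forall x, (i \in x) = b}.
Proof.
move=> iJ Sb y; rewrite inE => /orP[/Sb //|/exists_inP[j jJ /Sb]].
by rewrite flip_other //; apply: contraNneq iJ => ->.
Qed.

(* Splitting S along a coordinate of J: if both halves are nonempty, their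
   closed neighborhoods are disjoint; if S lies in one half, its translate is
   disjoint from its closed neighborhood in that half. *)
Lemma leq_cnbhd (J : {set I}) (S : {set {set I}}) :
  S != set0 -> {in S &, forall x y i, i \notin J -> (i \in x) = (i \in y)} ->
  1 + #|S| * #|J|.+1 <= #|cnbhd J S| + 'C(#|S|.+1, 2).
Proof.
have [k] := ubnPeq #|J|; elim: k J S => [|k IHk] J S.
  rewrite cards_eq0 => /eqP-> /set0Pn[x xS] Sagree.
  have -> : S = [set x].
    apply/setP=> y; rewrite inE; apply/idP/eqP=> [yS|-> //].
    by apply/setP=> i; apply: Sagree; rewrite ?inE.
  rewrite cards1 binn leq_add2r.
  by apply/card_gt0P; exists x; rewrite !inE eqxx.
move=> cJ Sn0 Sagree.
have /card_gt0P[i iJ] : 0 < #|J| by rewrite (eqP cJ).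
have cJ' : #|J :\ i| == k by move: cJ; rewrite (cardsD1 i J) iJ eqSS.
have iJ' : i \notin J :\ i by rewrite !inE eqxx.
have JJ' : J :\ i \subset J by apply: subD1set.
pose H (b : bool) := [set x in S | (i \in x) == b].
have HS b : H b \subset S by apply/subsetP=> x; rewrite inE => /andP[].
have Hb b : {in H b, forall x, (i \in x) = b}.
  by move=> x; rewrite inE => /andP[_ /eqP].
have HE b : H b != set0 ->
    1 + #|H b| * k.+1 <= #|cnbhd (J :\ i) (H b)| + 'C(#|H b|.+1, 2).
  move=> Hn0; apply: IHk => // x y xH yH j.
  rewrite !inE negb_and negbK => /orP[/eqP->|jJ].
    by rewrite (Hb _ _ xH) (Hb _ _ yH).
  by apply: Sagree => //; apply: (subsetP (HS b)).
have cS : #|S| = #|H true| + #|H false|.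
  rewrite -(cardsID [set x : {set I} | i \in x] S); congr (_ + _); apply: eq_card => x.
    by rewrite !inE eqb_id.
  by rewrite !inE eqbF_neg andbC.
have onesided b : H (~~ b) = set0 ->
    1 + #|S| * k.+2 <= #|cnbhd J S| + 'C(#|S|.+1, 2).
  move=> H0; have HSb : H b = S.
    apply/eqP; rewrite eqEsubset HS; apply/subsetP=> x xS; rewrite inE xS.
    move/setP/(_ x): H0; rewrite !inE xS /=.
    by case: (i \in x); case: (b).
  have := HE b; rewrite HSb => /(_ Sn0) IH.
  have : #|cnbhd (J :\ i) S| + #|flip i @: S| <= #|cnbhd J S|.
    apply: card_disjoint_sub; first exact: cnbhdS.
      apply/subsetP=> _ /imsetP[x xS ->]; rewrite inE; apply/orP; right.
      by apply/exists_inP; exists i => //; rewrite flipK.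
    apply/pred0P=> y /=; apply/negP=> /andP[yN /imsetP[x xS yE]].
    have Sb : {in S, forall x, (i \in x) = b} by rewrite -HSb.
    by move: (cnbhd_fix iJ' Sb yN); rewrite yE flip_at (Sb _ xS); case: (b).
  rewrite (card_imset _ (inv_inj (flipK i))) => cN; rewrite mulnS addnCA addnC.
    apply: leq_trans (leq_add IH (leqnn _)) _; by rewrite addnAC leq_add2r.
case: (eqVneq (H false) set0) => [/(onesided true) //|Hf].
case: (eqVneq (H true) set0) => [/(onesided false) //|Ht].
have := HE _ Hf; have := HE _ Ht.
have : #|cnbhd (J :\ i) (H true)| + #|cnbhd (J :\ i) (H false)|
       <= #|cnbhd J S|.
  apply: card_disjoint_sub; try exact: cnbhdS.
  apply/pred0P=> y /=; apply/negP=> /andP[y1 y0].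
  by have := cnbhd_fix iJ' (Hb _) y1; rewrite (cnbhd_fix iJ' (Hb _) y0).
(* Adding the two bounds leaves a + b <= 1 + a b, where a, b > 0 are the sizes of the halves. *)
move: Hf Ht; rewrite -!card_gt0 cS tri_add.
by nia.
Qed.

Lemma cube_cnbhd (S : {set {set I}}) :
  S != set0 -> 1 + #|S| * #|I|.+1 <= #|cnbhd setT S| + 'C(#|S|.+1, 2).
Proof.
move=> S0; rewrite -cardsT; apply: leq_cnbhd => // x y _ _ i.
by rewrite inE.
Qed.

(** Induction on the number of coordinates where [x] and [y] differ. *)
Lemma cube_connect (T : finType) (e : rel T) (f : {set I} -> T) :
  (forall i x, e (f x) (f (flip i x))) -> forall x y, connect e (f x) (f y).
Proof.
move=> eflip x y.
have [k] := ubnP #|[set i | (i \in x) != (i \in y)]|.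
elim: k x => // k IHk x.
case: (set_0Vmem [set i | (i \in x) != (i \in y)]) => [D0 _|[i iD] Dk].
  suff -> : x = y by [].
  by apply/setP=> i; move/setP/(_ i): D0; rewrite !inE => /negbFE/eqP.
apply: connect_trans (connect1 (eflip i x)) _; apply: IHk.
rewrite -ltnS; apply: leq_trans Dk; rewrite ltnS; apply: proper_card; apply/properP; split.
  apply/subsetP=> j; rewrite !inE; case: (eqVneq j i) => [->|_].
    by move: iD; rewrite inE.
  by rewrite addbF.
exists i => //; move: iD; rewrite !inE eqxx addbT.
by case: (_ \in x); case: (_ \in y).
Qed.

End Cube.

(** * Cluster coordinates and the edges of the dual cube *)

Section Coordinates.
Variable m : nat.
Implicit Types (c : bool) (l p : {set 'I_m}).

Fact lo_bound (i : 'I_m) : i < 2 * m.+1 - 1. Proof. by case: i => i /= H; lia. Qed.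
Fact hi_bound (i : 'I_m) : m + i < 2 * m.+1 - 1. Proof. by case: i => i /= H; lia. Qed.
Fact top_bound : 2 * m < 2 * m.+1 - 1. Proof. lia. Qed.

Definition lo i := Ordinal (lo_bound i).
Definition hi i := Ordinal (hi_bound i).
Definition top := Ordinal top_bound.

Variant bit_spec : 'I_(2 * m.+1 - 1) -> Type :=
  | BitLo i : bit_spec (lo i)
  | BitHi i : bit_spec (hi i)
  | BitTop : bit_spec top.

Lemma bitP k : bit_spec k.
Proof.
case: (ltnP k m) => [km|mk].
  by have -> : k = lo (Ordinal km) by [apply: val_inj]; constructor.
case: (ltnP k (2 * m)) => [km|mmk].
  have km' : k - m < m by lia.
  have -> : k = hi (Ordinal km') by apply: val_inj => /=; lia.
  by constructor.
have -> : k = top by apply: val_inj => /=; have := ltn_ord k; lia.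
by constructor.
Qed.

(* The vertex at position p of the cluster labelled l in class c (the last bit).
   The first m bits are the position when c is false and the label when c is
   true. *)
Definition mk c l p : dcvert m.+1 :=
  [ffun k : 'I_(2 * m.+1 - 1) =>
     if k < m then [exists i in (if c then l else p), lo i == k]
     else if k < 2 * m then [exists i in (if c then p else l), hi i == k]
     else c].

Lemma mk_lo c l p i : mk c l p (lo i) = (i \in if c then l else p).
Proof.
rewrite ffunE /= ltn_ord; apply/exists_inP/idP => [[j jA /eqP[/val_inj <-]] //|iA].
by exists i.
Qed.

Lemma mk_hi c l p i : mk c l p (hi i) = (i \in if c then p else l).
Proof.
rewrite ffunE /= ltnNge leq_addr /= mul2n -addnn ltn_add2l ltn_ord.
apply/exists_inP/idP => [[j jA /eqP[/addnI/val_inj <-]] //|iA].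
by exists i.
Qed.

Lemma mk_top c l p : mk c l p top = c.
Proof. by rewrite ffunE /= ltnNge leq_pmull //= ltnn. Qed.

Lemma mk_inj c l p c' l' p' :
  mk c l p = mk c' l' p' -> [/\ c = c', l = l' & p = p'].
Proof.
move=> E; have cc : c = c' by rewrite -(mk_top c l p) E mk_top.
subst c'.
have EL i : (i \in if c then l else p) = (i \in if c then l' else p').
  by rewrite -mk_lo E mk_lo.
have EH i : (i \in if c then p else l) = (i \in if c then p' else l').
  by rewrite -mk_hi E mk_hi.
by case: c EL EH {E} => EL EH; split=> //; apply/setP=> i.
Qed.

Lemma dc_adj_sym : symmetric (@dc_adj m.+1).
Proof.
move=> u v; apply: eq_existsb => i; rewrite eq_sym.
congr [&& _, _ & _]; first by apply: eq_forallb => j; rewrite (eq_sym (u j)).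
by case: ifP => _; [|case: ifP => _ //]; apply: eq_forallb => j; rewrite andbC.
Qed.

Lemma all_top (f : 'I_(2 * m.+1 - 1) -> bool) :
  [forall j : 'I_(2 * m.+1 - 1), (j == 2 * m.+1 - 2 :> nat) ==> f j] = f top.
Proof.
apply/forallP/idP => [/(_ top)/implyP-> //|ft j].
  by apply/eqP=> /=; lia.
apply/implyP=> /eqP jE; suff -> : j = top by [].
by apply: val_inj; rewrite /= jE; lia.
Qed.

Lemma dc_adj_flip c l p i : dc_adj (mk c l p) (mk c l (flip i p)).
Proof.
apply/existsP; exists (if c then hi i else lo i).
rewrite !all_top !mk_top; case: c => /=; rewrite ?mk_hi ?mk_lo flip_at.
  have /negbTE -> : ~~ (m + i < m.+1 - 1) by lia.
  have -> : m + i < 2 * m.+1 - 2 by have := ltn_ord i; lia.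
  rewrite andbT; apply/andP; split; first by case: (i \in p).
  apply/forallP=> k; apply/implyP; case: (bitP k) => [j|j|] kn.
  - by rewrite !mk_lo.
  - rewrite !mk_hi flip_other //; apply: contraNneq kn => -> //.
  - by rewrite !mk_top.
have -> : i < m.+1 - 1 by have := ltn_ord i; lia.
rewrite andbT; apply/andP; split; first by case: (i \in p).
apply/forallP=> k; apply/implyP; case: (bitP k) => [j|j|] kn.
- rewrite !mk_lo flip_other //; apply: contraNneq kn => -> //.
- by rewrite !mk_hi.
- by rewrite !mk_top.
Qed.

(** Switching the last bit keeps the other bits but exchanges the roles of label and position. *)
Lemma dc_adj_cross c l p : dc_adj (mk c l p) (mk (~~ c) p l).
Proof.
apply/existsP; exists top; rewrite !mk_top.
have /negbTE -> : ~~ (top < m.+1 - 1) by rewrite /=; lia.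
have /negbTE -> : ~~ (top < 2 * m.+1 - 2) by rewrite /=; lia.
rewrite andbT; apply/andP; split; first by case: c.
apply/forallP=> k; apply/implyP; case: (bitP k) => [j|j|] kn.
- by rewrite !mk_lo; case: c.
- by rewrite !mk_hi; case: c.
- by rewrite eqxx in kn.
Qed.

Lemma dc_adj_inv c l p v :
  dc_adj (mk c l p) v ->
  v = mk (~~ c) p l \/ exists i, v = mk c l (flip i p).
Proof.
case/existsP=> k /and3P[uvk /forallP uv]; rewrite !all_top mk_top.
have {}uv j : j != k -> v j = mk c l p j by move=> /(implyP (uv j))/eqP.
have vk : v k = ~~ mk c l p k by move: uvk; case: (v k); case: (mk _ _ _ _).
case: (bitP k) uv vk {uvk} => [i|i|] uv vk.
- have -> : lo i < m.+1 - 1 by have := ltn_ord i; rewrite /=; lia.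
  case/andP=> /negbTE cF _; subst c; right; exists i.
  apply/ffunP=> j; case: (eqVneq j (lo i)) => [->|jn].
    by rewrite vk !mk_lo flip_at.
  rewrite uv //; case: (bitP j) jn => [a|a|] jn; rewrite ?mk_lo ?mk_hi ?mk_top //.
  by rewrite flip_other //; apply: contraNneq jn => ->.
- have /negbTE -> : ~~ (hi i < m.+1 - 1) by rewrite /=; lia.
  have -> : hi i < 2 * m.+1 - 2 by have := ltn_ord i; rewrite /=; lia.
  case/andP=> cT _; rewrite cT in uv vk *; right; exists i.
  apply/ffunP=> j; case: (eqVneq j (hi i)) => [->|jn].
    by rewrite vk !mk_hi flip_at.
  rewrite uv //; case: (bitP j) jn => [a|a|] jn; rewrite ?mk_lo ?mk_hi ?mk_top //.
  by rewrite flip_other //; apply: contraNneq jn => ->.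
- move=> _; left; apply/ffunP=> j; case: (eqVneq j top) => [->|jn].
    by rewrite vk !mk_top.
  rewrite uv //; case: (bitP j) jn => [a|a|] jn; rewrite ?mk_lo ?mk_hi ?mk_top //.
  - by case: c {uv vk}.
  - by case: c {uv vk}.
  - by rewrite eqxx in jn.
Qed.

End Coordinates.

(** * Adding up the bounds of the clusters *)

Lemma tri_double d : 2 * 'C(d.+1, 2) = d * d.+1.
Proof. by elim: d => // d IHd; rewrite binS bin1; lia. Qed.

(** The map t -> t m - C(t + 1, 2) grows by m - t from t - 1 to t, hence is nondecreasing up to
    m. *)
Lemma tri_shrink m x x' f :
  x' <= x <= m -> 1 + x * m <= f + 'C(x.+1, 2) ->
  1 + x' * m <= f + 'C(x'.+1, 2).
Proof.
case/andP=> xx xm; have -> : x = x' + (x - x') by lia.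
by rewrite tri_add; have := tri_double (x - x'); nia.
Qed.

Lemma tri_sum (J : Type) (s : seq J) (x f : J -> nat) m r :
  0 < r <= m -> (forall j, x j < r) ->
  (forall j, 0 < x j -> 1 + x j * m <= f j + 'C((x j).+1, 2)) ->
  r <= \sum_(j <- s) x j ->
  1 + r * m.+1 <= \sum_(j <- s) f j + 'C(r.+1, 2).
Proof.
case/andP=> r0 rm xr xf.
pose X s := \sum_(j <- s) x j; pose Y s := \sum_(j <- s) f j.
(* Below [r] a partial sum keeps only the factor [m]. The missing [r] is gained when two positive
   terms together reach [r], which must happen since each [x j] is below [r]. *)
suff [] : (0 < X s < r -> 1 + X s * m <= Y s + 'C((X s).+1, 2)) /\
          (r <= X s -> 1 + r * m.+1 <= Y s + 'C(r.+1, 2)) by [].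
elim: s => [|j s [IHlt IHge]]; first by rewrite /X !big_nil; lia.
have -> : X (j :: s) = x j + X s by rewrite /X big_cons.
have -> : Y (j :: s) = f j + Y s by rewrite /Y big_cons.
have xrj := xr j; have xfj := xf j.
have [rX|Xr] := leqP r (X s).
  by split=> [/andP[_]|_]; [|have := IHge rX]; lia.
have [xj0|xj0] := posnP (x j).
  by rewrite xj0 add0n; split=> [H|]; [have := IHlt H|]; lia.
have [X0|X0] := posnP (X s).
  by rewrite X0 addn0; split=> [H|]; [have := xfj xj0|]; lia.
have {IHlt}Hlt := IHlt (introT andP (conj X0 Xr)); have {}xfj := xfj xj0.
split=> [lt|ge]; first by rewrite tri_add; nia.
(* Cutting [x j] down to z = r - X s makes the total exactly [r]; what remains is z + X s <= 1 + z *
   X s with both positive. *)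
have zb : r - X s <= x j <= m by lia.
move: (tri_shrink zb xfj); have [z rE] : exists z, r = z + X s.
  by exists (r - X s); lia.
have z0 : 0 < z by lia.
by rewrite rE addnK tri_add; nia.
Qed.

(** * Components outside a cut, and counting by clusters *)

(** Of the at least r + 1 component roots outside [F], at most one is the root of [x0]; the others
    are unreachable from it. *)
Lemma card_unreached (T : finType) (e : rel T) (F : {set T}) r x0 :
  symmetric e -> is_rcut e r.+1 F -> x0 \notin F ->
  r <= #|[set y | (y \notin F) && ~~ connect (del_rel e F) x0 y]|.
Proof.
move=> esym cutF x0F.
have csym : connect_sym (del_rel e F).
  apply: sym_connect_sym => x y; rewrite /del_rel esym.
  by case: (_ \in F); case: (_ \in F).
pose R := [set y in roots (del_rel e F) | y \notin F].
have cR : r < #|R|.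
  apply: leq_trans cutF _; rewrite /ncomp_del /n_comp_mem; apply: subset_leq_card.
  by apply/subsetP=> y; rewrite !inE.
have : r <= #|R :\ root (del_rel e F) x0|.
  by move: cR; rewrite (cardsD1 (root (del_rel e F) x0)); case: (_ \in R); lia.
move/leq_trans; apply; apply: subset_leq_card.
apply/subsetP=> y; rewrite !inE => /and3P[yx /eqP yr ->] /=.
by apply: contra yx => /(rootP csym) xy; rewrite xy yr.
Qed.

Section Slices.
Variable m : nat.
Implicit Types (c : bool) (l p : {set 'I_m}) (A : {set dcvert m.+1}).

Definition slice A c l := [set p | mk c l p \in A].

Lemma card_slices A : #|A| = \sum_c \sum_l #|slice A c l|.
Proof.
pose g (t : bool * ({set 'I_m} * {set 'I_m})) := mk t.1 t.2.1 t.2.2.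
(* Injectivity suffices, as 2 * 2^m * 2^m = 2^(2m+1). *)
have gbij : bijective g.
  apply: inj_card_bij => [[c [l p]] [c' [l' p']] /mk_inj[/= -> -> ->] //|].
  rewrite !card_prod card_bool !card_ffun card_bool !card_ord -cardsT.
  rewrite -[[set: _]]powersetT card_powerset cardsT card_ord -expnD -expnS.
  by rewrite leq_exp2l //; lia.
rewrite -sum1_card big_mkcond (reindex g) /=; last exact: onW_bij.
rewrite -(pair_bigA _ (fun c t => if g (c, t) \in A then 1 else 0)) /=.
apply: eq_bigr => c _.
rewrite -(pair_bigA _ (fun l p => if mk c l p \in A then 1 else 0)) /=.
apply: eq_bigr => l _; rewrite -sum1_card [RHS]big_mkcond.
by apply: eq_bigr => p _; rewrite inE.
Qed.

Lemma card_slices_pair A :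
  #|A| = \sum_(j : bool * {set 'I_m}) #|slice A j.1 j.2|.
Proof. by rewrite card_slices (pair_bigA _ (fun c l => #|slice A c l|)). Qed.

Lemma leq_class A c : \sum_l #|slice A c l| <= #|A|.
Proof. by rewrite card_slices big_bool; case: c; rewrite ?leq_addr ?leq_addl. Qed.

End Slices.

(** The difference r (m + 1) - C(r + 1, 2) increases up to r = m, where it is C(m + 1, 2). With
    [tri_lt_exp2], a cut below the claimed size has fewer than 2^m elements. *)
Lemma tri_bound m r : r <= m -> r * m.+1 <= 'C(m.+1, 2) + 'C(r.+1, 2).
Proof. by move=> rm; have := tri_double m; have := tri_double r; nia. Qed.

(** * Lower bound *)

Section LowerBound.
Variables (m : nat) (F : {set dcvert m.+1}).
Let D := del_rel (@dc_adj m.+1) F.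

Lemma clean_class c : #|F| < 2 ^ m -> exists l, slice F c l = set0.
Proof.
move=> F2; case: (pickP [pred l | slice F c l == set0]) => [l /eqP|dirty].
  by exists l.
move: F2; rewrite ltnNge => /negP; case.
apply: leq_trans (leq_class F c); rewrite -{1}[m]card_ord -cardsT -card_powerset.
rewrite powersetT cardsT -sum1_card; apply: leq_sum => l _.
by rewrite card_gt0; apply/negbT/dirty.
Qed.

Lemma slice0 c l p : slice F c l = set0 -> mk c l p \notin F.
Proof. by move/setP/(_ p); rewrite !inE => ->. Qed.

Lemma clean_connect c l p q :
  slice F c l = set0 -> connect D (mk c l p) (mk c l q).
Proof.
move=> cl; apply: (cube_connect (f := mk c l)) => i x.
by rewrite /D /del_rel !slice0 ?dc_adj_flip.
Qed.

Lemma clean_connect_cross c l l' p q :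
  slice F c l = set0 -> slice F (~~ c) l' = set0 ->
  connect D (mk c l p) (mk (~~ c) l' q).
Proof.
move=> cl cl'; apply: connect_trans (clean_connect p l' cl) _.
apply: connect_trans (clean_connect l q cl'); apply: connect1.
by rewrite /D /del_rel !slice0 ?dc_adj_cross.
Qed.

Lemma rcut_lower_bound r :
  0 < r <= m -> is_rcut (@dc_adj m.+1) r.+1 F ->
  1 + r * m.+1 <= #|F| + 'C(r.+1, 2).
Proof.
move=> rm cutF; rewrite leqNgt; apply/negP=> small.
have F2 : #|F| < 2 ^ m.
  have /andP[_ /tri_bound] := rm; have := tri_lt_exp2 m; lia.
have [l0 cl0] := clean_class false F2; have [l1 cl1] := clean_class true F2.
pose x0 := mk false l0 l1.
have := card_unreached (dc_adj_sym (m := m)) cutF (slice0 l1 cl0).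
set S := [set y | _] => rS.
have S_step u v : u \in S -> dc_adj u v -> (v \in S) || (v \in F).
  rewrite !inE => /andP[uF xu] uv; case: (boolP (v \in F)) => //= vF.
  rewrite orbF; apply: contra xu => xv; apply: connect_trans xv (connect1 _).
  by rewrite /del_rel vF uF dc_adj_sym.
have S_clean c l : slice F c l = set0 -> slice S c l = set0.
  move=> cl; apply/setP=> p; rewrite !inE; apply/negP=> /andP[_ /negP]; apply.
  case: c cl => cl; first exact: (clean_connect_cross (c := false)).
  apply: connect_trans (clean_connect_cross (c := true) l0 p cl1 cl).
  exact: (clean_connect_cross (c := false)).
have S_dirty c l p : mk c l p \in S -> 0 < #|slice F c l|.
  move=> pS; rewrite card_gt0; apply/eqP=> /S_clean/setP/(_ p).
  by rewrite !inE in pS *; rewrite pS.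
have S_cnbhd c l (A : {set {set 'I_m}}) : A \subset slice S c l ->
    #|cnbhd setT A| <= #|slice S c l| + #|slice F c l|.
  move=> AS; apply: leq_trans (leq_card_setU _ _).1.
  apply: subset_leq_card; apply/subsetP=> y.
  rewrite in_setU inE => /orP[/(subsetP AS)-> //|].
  case/exists_inP=> i _ /(subsetP AS); rewrite !(in_set (fun p => mk c l p \in _)).
  by move=> yS; apply: S_step yS _; rewrite -{2}[y](flipK i) dc_adj_flip.
(* The cross neighbors of distinct positions lie in distinct opposite clusters. Each is in [F], or
   in [S] and so in a dirty cluster; either way its cluster meets [F]. *)
have S_opp c l : #|slice S c l| + #|slice F c l| <= #|F|.
  have oppF : #|slice S c l| <= \sum_l' #|slice F (~~ c) l'|.
    rewrite -sum1_card big_mkcond; apply: leq_sum => p _.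
    case: ifP => //; rewrite inE => pS.
    have := S_step _ _ pS (dc_adj_cross c l p) => /orP[/S_dirty //|pF].
    by rewrite card_gt0; apply/set0Pn; exists l; rewrite inE.
  have : #|slice F c l| <= \sum_l' #|slice F c l'| by rewrite (bigD1 l) //= leq_addr.
  by rewrite (card_slices F) big_bool; case: (c) oppF => /=; lia.
case: (boolP [exists c, exists l, r <= #|slice S c l|]) => [big|].
  case/existsP: big => c /existsP[l big].
  (* Exactly [r] vertices are taken because the cube bound is not monotone in the size of the
     set. *)
  have [A AS cA] : exists2 A : {set {set 'I_m}}, A \subset slice S c l & #|A| = r.
    have : 0 < #|[set A : {set {set 'I_m}} | A \subset slice S c l & #|A| == r]|.
      by rewrite cards_draws bin_gt0.
    by case/card_gt0P=> A; rewrite inE => /andP[AS /eqP]; exists A.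
  have := cube_cnbhd (S := A); rewrite -card_gt0 cA card_ord => /(_ _).
  by have := S_cnbhd _ _ _ AS; have := S_opp c l; lia.
rewrite negb_exists => /forallP small_slices.
pose J := (bool * {set 'I_m})%type.
have sl (j : J) : #|slice S j.1 j.2| < r.
  by have := small_slices j.1; rewrite negb_exists => /forallP/(_ j.2); rewrite -ltnNge.
move: small; rewrite ltnNge => /negP; apply; rewrite (card_slices_pair F).
apply: (tri_sum rm sl) => [j Sj|]; last by rewrite -card_slices_pair.
have := cube_cnbhd (S := slice S j.1 j.2); rewrite -card_gt0 card_ord => /(_ Sj) /=.
(* Removing the vertices of [S] from the closed neighborhood lowers the factor m + 1 to m. *)
rewrite mulnS; have := S_cnbhd j.1 j.2 _ (subxx _).
have arith x y f N t : N <= x + f -> 1 + (x + y) <= N + t -> 1 + y <= f + t by lia.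
exact: arith.
Qed.

End LowerBound.

(** * Upper bound *)

(** Each vertex of [A] becomes a component by itself, and the component of [x0] is one more. *)
Lemma rcut_isolate (T : finType) (e : rel T) (F A : {set T}) x0 :
  symmetric e -> [disjoint A & F] ->
  {in A, forall x y, e x y -> y \in F} -> x0 \notin F -> x0 \notin A ->
  is_rcut e #|A|.+1 F.
Proof.
move=> esym /pred0P dAF AF x0F x0A; pose D := del_rel e F.
have csym : connect_sym D.
  apply: sym_connect_sym => x y; rewrite /D /del_rel esym.
  by case: (_ \in F); case: (_ \in F).
have isol x y : x \in A -> connect D x y -> y = x.
  move=> xA /connectP[[|z p] //= /andP[/and3P[_ zF /(AF _ xA)]]].
  by rewrite (negbTE zF).
have closF : closed D (~: F).
  by apply: (intro_closed csym) => x y /and3P[_ yF _] _; rewrite inE.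
have x0z := connect_root D x0; set z := root D x0 in x0z.
have zF : z \in ~: F by rewrite -(closed_connect closF x0z) inE.
have zA : z \notin A.
  by apply: contra x0A => zA; rewrite (isol z x0) // csym.
rewrite /is_rcut /ncomp_del /n_comp_mem.
have -> : #|A|.+1 = #|z |: A| by rewrite cardsU1 zA.
apply: subset_leq_card; apply/subsetP=> x; rewrite in_setU1 !inE.
case/predU1P=> [->|xA].
  by move: zF; rewrite inE => ->; rewrite (roots_root csym).
apply/andP; split; last by have := dAF x; rewrite /= xA => /= ->.
by apply/eqP; apply: isol => //; apply: connect_root.
Qed.

Section UpperBound.
Variables (m r : nat).

Let R := [set i : 'I_m | i < r].
Let isolated := [set mk false set0 [set i] | i in R].
(** The pairs meeting [R] are the cube neighbors, other than the origin, of the isolated singletons;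
    [cut] adds the origin and the cross neighbors. *)
Let near := [set X : {set 'I_m} | (#|X| == 2) && ~~ (X \subset ~: R)].
Let cut := mk false set0 (set0 : {set 'I_m}) |:
  ((mk false set0 @: near) :|: [set mk true [set i] set0 | i in R]).

Lemma card_initial : r <= m -> #|R| = r.
Proof.
move=> rm; have winj : injective (widen_ord rm).
  by move=> i j ij; apply: ord_inj; apply: (congr1 (@nat_of_ord m) ij).
rewrite -[RHS]card_ord -(card_imset _ winj).
apply: eq_card => i; rewrite inE; apply/idP/imsetP => [ir|[j _ ->]].
  by exists (Ordinal ir) => //; apply: val_inj.
exact: (ltn_ord j).
Qed.

Lemma card_cut : r <= m -> #|cut| <= 1 + r * m.+1 - 'C(r.+1, 2).
Proof.
move=> rm; have cR := card_initial rm.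
(* The pairs missing [R] are those inside its complement, which has m - r elements. *)
have cN : #|near| + 'C(m - r, 2) = 'C(m, 2).
  have <- : #|~: R| = m - r by rewrite cardsCs setCK card_ord cR.
  have -> : 'C(m, 2) = #|[set X : {set 'I_m} | #|X| == 2]|.
    by rewrite card_draws card_ord.
  rewrite -cards_draws.
  rewrite -(cardsID [set X : {set 'I_m} | X \subset ~: R] [set X : {set 'I_m} | #|X| == 2]).
  rewrite addnC; congr (_ + _); apply: eq_card => X; rewrite !inE.
    by rewrite andbC.
  by rewrite andbC.
have cutN : #|cut| <= 1 + (#|near| + r).
  apply: leq_trans (leq_card_setU _ _).1 _; rewrite cards1 leq_add2l.
  apply: leq_trans (leq_card_setU _ _).1 _; apply: leq_add.
    exact: leq_imset_card.
  by rewrite -[leqRHS]cR; apply: leq_imset_card.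
apply: leq_trans cutN _; move: cN; move: #|near| => N.
have [d mE] : exists d, m = r + d by exists (m - r); lia.
have tm : 'C(m.+1, 2) = 'C(m, 2) + m by rewrite binS bin1.
have td : 'C(d.+1, 2) = 'C(d, 2) + d by rewrite binS bin1.
have := tri_add r d; have := tri_double r.
rewrite mE addKn in tm *; nia.
Qed.

Lemma flip_set1 (i j : 'I_m) :
  flip j [set i] = if j == i then set0 else [set i; j].
Proof.
apply/setP=> k; rewrite !inE.
case: (eqVneq j i) => [->|ji]; first by rewrite addbb inE.
rewrite !inE; case: (eqVneq k i) => [->|] //=.
by rewrite eq_sym (negbTE ji).
Qed.

Lemma rcut_upper_bound : r <= m -> is_rcut (@dc_adj m.+1) r.+1 cut.
Proof.
move=> rm; have <- : #|isolated| = r.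
  by rewrite card_imset ?card_initial // => i j /mk_inj[_ _ /set1_inj].
(* The cross neighbor of the origin survives: the vertices of [cut] in its class have nonempty
   labels. *)
apply: (rcut_isolate (x0 := mk true set0 set0)).
- exact: dc_adj_sym.
- apply/pred0P=> v /=; apply/negP=> /andP[/imsetP[i iR ->]].
  rewrite !inE => /or3P[/eqP/mk_inj[_ _]|/imsetP[X XN /mk_inj[_ _]]|].
  + by move/setP/(_ i); rewrite !inE eqxx.
  + by move=> iX; move: XN; rewrite !inE -iX cards1.
  + by case/imsetP=> j _ /mk_inj[].
- move=> _ /imsetP[i iR ->] v /dc_adj_inv[->|[j ->]]; rewrite !inE.
    by apply/or3P/Or33/imsetP; exists i.
  rewrite flip_set1; case: (eqVneq j i) => [_|ji]; first by rewrite eqxx.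
  apply/or3P/Or32/imset_f; rewrite inE cards2 (eq_sym i) ji /=.
  by apply/subsetPn; exists i; rewrite !inE ?eqxx // negbK; rewrite inE in iR.
- rewrite !inE; apply/or3P=> -[/eqP/mk_inj[] //|/imsetP[X _ /mk_inj[] //]|].
  by case/imsetP=> i _ /mk_inj[_ /setP/(_ i)]; rewrite !inE eqxx.
- by apply/imsetP=> -[i _ /mk_inj[]].
Qed.

End UpperBound.


Lemma dc_not_complete m : 0 < m -> ~~ complete_graph (@dc_adj m.+1).
Proof.
move=> m0; apply/negP=> /forallP complete; pose i := Ordinal m0.
have s0 : [set i] <> set0 by move/setP/(_ i); rewrite !inE eqxx.
(* These two vertices differ in both bit [lo i] and the last bit. *)
have /forallP/(_ (mk true [set i] set0))/implyP := complete (mk false set0 set0).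
have /[swap]/[apply] : mk false set0 set0 != mk true [set i] set0.
  by apply/eqP=> /mk_inj[].
by case/dc_adj_inv=> [/mk_inj[_ /s0]|[j /mk_inj[]]].
Qed.

Theorem mainTheorem8 (n r : nat) :
  2 <= n -> 1 <= r <= n - 1 ->
  ~~ complete_graph (@dc_adj n) /\
  is_ckappa (@dc_adj n) r.+1 (r * n - (r * (r + 1)) %/ 2 + 1).
Proof.
case: n => [//|m] m1; rewrite subn1 /= => /[dup] r1m /andP[r1 rm].
split; first exact: dc_not_complete.
(* Moving the 1 across the truncated subtraction is sound because C(r + 1, 2) <= r (m + 1). *)
have -> : r * m.+1 - r * (r + 1) %/ 2 + 1 = 1 + r * m.+1 - 'C(r.+1, 2).
  by rewrite tri_half; have := tri_double r; nia.
have lower F : is_rcut (@dc_adj m.+1) r.+1 F ->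
    1 + r * m.+1 - 'C(r.+1, 2) <= #|F|.
  by move=> /(rcut_lower_bound r1m); rewrite leq_subLR [leqRHS]addnC.
split=> //; have cutP := rcut_upper_bound rm.
eexists; split; first exact: cutP.
by apply/eqP; rewrite eqn_leq lower // andbT; apply: card_cut.
Qed.
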